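(* Fix an integer $d\geq2$. For all $n\geq 0$ and $j\in\mathbb{Z}$, $$((d-1)n+2+(d+1)j)\,(w_{d,n},t^{-j})=((d-1)n+2-(d+1)j)\,(w_{d,n},t^j),$$ where $(w_{d,n},t^j)$ is the coefficient of $t^j$ in $w_{d,n}$.
   Context: For $n\geq0$ let $P_{(d-1)n}$ be a strictly convex polygon with $(d-1)n+2$ vertices and a marked boundary edge $e_*$. A $d$-dissection of it is a decomposition into $n$ non-overlapping convex polygons each having $d+1$ vertices, all among the vertices of $P_{(d-1)n}$. Its checkerboard colouring colours each of these polygons black or white such that the unique polygon containing $e_*$ is black and polygons sharing an edge have different colours; let $n_b,n_w$ be the numbers of black and white polygons. Define $w_{d,n}(t)=\sum t^{n_b-n_w}\in\mathbb{N}[t,t^{-1}]$, the sum over all $d$-dissections of $P_{(d-1)n}$, with $w_{d,0}=1$. *)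

(* Defs.v *)
From HB Require Import structures.
From mathcomp Require Import all_boot all_order all_algebra.
From mathcomp.multinomials Require monalg.

Set Implicit Arguments.
Unset Strict Implicit.
Unset Printing Implicit Defensive.

Import Order.TTheory GRing.Theory Num.Theory.

(* The notations of monalg clash with those of mathcomp-analysis, so monalg is
   imported in this module only. *)
Module Laurent.
Import monalg.
Local Open Scope ring_scope.

(* Laurent polynomials in t, as finitely supported functions from exponents
   to coefficients.  The library requires the coefficients to form an abelian
   group, hence int rather than nat. *)
Definition laurent := {malg int[int]}.

#[export] HB.instance Definition _ := GRing.Zmodule.on laurent.

Definition tpow (k : int) : laurent := << 1 *g k >>.

Definition lcoef (f : laurent) (k : int) : int := f@_k.

Module Exports. HB.reexport. End Exports.
End Laurent.
Export Laurent.Exports.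

Notation laurent := Laurent.laurent.
Notation tpow := Laurent.tpow.
Notation lcoef := Laurent.lcoef.

From mathcomp Require Import all_classical all_reals all_analysis.

Import numFieldNormedType.Exports.

Local Open Scope classical_set_scope.
Local Open Scope ring_scope.

Section Polygon.
Context {R : realType}.

(* Twice the signed area of the triangle a b c; it is positive iff c lies
   strictly to the left of the directed line from a to b. *)
Definition orient (a b c : R * R) : R :=
  (b.1 - a.1) * (c.2 - a.2) - (b.2 - a.2) * (c.1 - a.1).

(* A strictly convex polygon is given by the list p of its vertices in
   counterclockwise order.  The list starts right after the marked boundary
   edge e_*, so that e_* joins the last vertex to the first one. *)
Definition strictly_convex N (p : 'I_N -> R * R) : Prop :=
  forall i j k : 'I_N, (i < j < k)%N -> 0 < orient (p i) (p j) (p k).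

(* The (closed) convex polygon spanned by the vertices with labels in S. *)
Definition hull N (p : 'I_N -> R * R) (S : {set 'I_N}) : set (R * R) :=
  [set x | exists l : 'I_N -> R,
     [/\ forall i, 0 <= l i,
         forall i, i \notin S -> l i = 0,
         \sum_i l i = 1,
         x.1 = \sum_i l i * (p i).1 &
         x.2 = \sum_i l i * (p i).2]].

Definition nonoverlapping (A B : set (R * R)) : Prop :=
  interior A `&` interior B = set0.

(* Decompositions into m convex k-gons.  A piece is represented by its set of
   vertices, which determines it since the vertices of the polygon are in
   strictly convex position. *)
Definition is_dissection N (p : 'I_N -> R * R) (k m : nat)
    (D : {set {set 'I_N}}) : Prop :=
  [/\ #|D| = m,
      forall S, S \in D -> #|S| = k,
      forall S T, S \in D -> T \in D -> S <> T ->
        nonoverlapping (hull p S) (hull p T) &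
      \bigcup_(S in [set` D]) hull p S = hull p [set: 'I_N]%SET].

(* The edges of the piece S, each given by its two endpoints. *)
Definition edges N (p : 'I_N -> R * R) (S : {set 'I_N}) : {set {set 'I_N}} :=
  [set [set a; b]%SET | a in S, b in S &
     (a != b) &&
     [forall c in S :\: [set a; b]%SET, 0 < orient (p a) (p b) (p c)]]%SET.

Definition marked_edge N : {set 'I_N.+2} := [set ord_max; ord0]%SET.

(* B is the set of black pieces of D. *)
Definition checkerboard N (p : 'I_N.+2 -> R * R) (D B : {set {set 'I_N.+2}})
    : bool :=
  [&& B \subset D,
      [forall S in D, (marked_edge N \in edges p S) ==> (S \in B)] &
      [forall S in D, [forall T in D,
         (S != T) && (edges p S :&: edges p T != finset.set0) ==>
         ((S \in B) != (T \in B))]]].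

(* The checkerboard colouring of a dissection exists and is unique; the default
   value set0 is never used on dissections. *)
Definition black N (p : 'I_N.+2 -> R * R) (D : {set {set 'I_N.+2}})
    : {set {set 'I_N.+2}} :=
  odflt finset.set0
    [pick B : {set {set 'I_N.+2}} | checkerboard p D B].

Definition n_b N (p : 'I_N.+2 -> R * R) (D : {set {set 'I_N.+2}}) : nat :=
  #|black p D|.

Definition n_w N (p : 'I_N.+2 -> R * R) (D : {set {set 'I_N.+2}}) : nat :=
  #|D :\: black p D|.

(* The value at n = 0 is a convention: a polygon with two vertices is a
   nonempty segment, so it has no dissection in the above sense. *)
Definition w (d n : nat) (p : 'I_((d - 1) * n).+2 -> R * R) : laurent :=
  if n is 0 then tpow 0
  else \sum_(D : {set {set 'I_((d - 1) * n).+2}} |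
              `[< is_dissection p d.+1 n D >])
         tpow ((n_b p D)%:Z - (n_w p D)%:Z).

End Polygon.

Arguments w {R} d n p.

(* Main.v *)
(* Let N = (d - 1) n + 2 and let X = n_b - n_w be the imbalance of a dissection.
   Every diagonal of a dissection borders one black and one white piece, so it
   cancels in the count of black minus white sides of pieces, and (d + 1) X is
   the number of black minus the number of white boundary edges.  Choosing
   another boundary edge as the marked one keeps X if this edge is black and
   negates X if it is white, while the number c_j of dissections of imbalance j
   does not change.  Counting in two ways the pairs of a dissection and a
   boundary edge which, once marked, gives imbalance j, we get
   N c_j = (N + (d + 1) j) / 2 * (c_j + c_{-j}).
   That c_j does not depend on the marked edge requires the geometric notion of
   dissection to depend only on the cyclic order of the vertices. *)

Require Import Defs.
From mathcomp Require Import all_boot all_order all_algebra.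
From mathcomp Require Import all_classical all_reals all_analysis.
From mathcomp Require Import zify ring lra.
From mathcomp.multinomials Require monalg.

Set Implicit Arguments.
Unset Strict Implicit.
Unset Printing Implicit Defensive.

Import Order.TTheory GRing.Theory Num.Theory.
Import numFieldNormedType.Exports.

(** * Cyclic order and directed edges *)

Section Cyclic.
Context {N : nat}.
Implicit Types (a b c u v x : 'I_N.+2) (S T : {set 'I_N.+2}).

(** Combinatorial form of [0 < orient]: the labels are distinct and occur in this cyclic order. The
    two are identified in [orient_gt0]. *)
Definition ccw a b c := [|| a < b < c, b < c < a | c < a < b].

(** Number of counterclockwise steps from [a] to [b], the measure for extremal choices and for
    descent. *)
Definition gap a b := if a <= b then b - a else b + N.+2 - a.

Lemma gap_lt a b c : ccw a b c -> gap a b < gap a c.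
Proof.
rewrite /ccw /gap; have := ltn_ord a; have := ltn_ord b; have := ltn_ord c.
case: (leqP a b); case: (leqP a c); lia.
Qed.

Lemma ord_neqE a b : (a == b) = (a == b :> nat).
Proof. by []. Qed.

Lemma ordDE a b : (a + b)%R = (if a + b < N.+2 then a + b else a + b - N.+2) :> nat.
Proof.
rewrite /=; have := ltn_ord a; have := ltn_ord b => lb la.
case: (ltnP (a + b)) => h; first by rewrite modn_small.
rewrite -{1}(subnK h) modnDr modn_small //; lia.
Qed.

Lemma ccwD i a b c : ccw (a + i)%R (b + i)%R (c + i)%R = ccw a b c.
Proof.
rewrite /ccw !ordDE; have := ltn_ord a; have := ltn_ord b; have := ltn_ord c.
have := ltn_ord i; case: (ltnP (a + i)); case: (ltnP (b + i)); case: (ltnP (c + i)); lia.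
Qed.

Lemma ccw_rot a b c : ccw a b c = ccw b c a.
Proof. rewrite /ccw; lia. Qed.

Lemma ccw_ltE a b c : a < b -> ccw a b c = (c < a) || (b < c).
Proof. rewrite /ccw; lia. Qed.

Lemma ccw_gtE a b c : b < a -> ccw a b c = (b < c < a).
Proof. rewrite /ccw; lia. Qed.

Lemma ccw_or a b c : a != b -> a != c -> b != c -> ~~ ccw a b c -> ccw a c b.
Proof. rewrite !ord_neqE /ccw; lia. Qed.

(** A side of the piece, directed so that the piece lies on its left. The direction distinguishes
    the two pieces at a diagonal. *)
Definition dedge S a b :=
  [&& a \in S, b \in S, a != b & [forall c in S :\: [set a; b], ccw a b c]].

Lemma dedgeP S a b :
  reflect [/\ a \in S, b \in S, a != b &
             forall c, c \in S -> c != a -> c != b -> ccw a b c]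
          (dedge S a b).
Proof.
apply: (iffP and4P) => -[aS bS ab H]; split => //.
  move=> c cS ca cb; apply: (forall_inP H); by rewrite !inE negb_or ca cb.
apply/forall_inP => c; rewrite !inE negb_or => /andP[/andP[ca cb] cS]; exact: H.
Qed.

Lemma dedge_next S a : a \in S -> 1 < #|S| -> exists b, dedge S a b.
Proof.
move=> aS /card_gt1P[x [y [xS yS xy]]].
have [b0 /andP[b0S b0a]] : exists b, (b \in S) && (b != a).
  by case: (eqVneq x a) => [xa|]; [exists y; rewrite yS -xa eq_sym | exists x; rewrite xS].
case: (@arg_minnP _ b0 (fun b => (b \in S) && (b != a)) (gap a)) => [|b /andP[bS ba] H].
  by rewrite b0S.
exists b; apply/dedgeP; split => //; first by rewrite eq_sym.
move=> c cS ca cb; have /= := H c; rewrite cS ca => /(_ isT).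
move: ca cb ba; rewrite !ord_neqE /gap /ccw; have := ltn_ord a; have := ltn_ord b.
have := ltn_ord c; case: (leqP a b); case: (leqP a c); lia.
Qed.

Lemma dedge_inj S a b b' : dedge S a b -> dedge S a b' -> b = b'.
Proof.
move=> /dedgeP[aS bS ab H] /dedgeP[_ b'S ab' H'].
apply/eqP/negPn/negP => bb'.
have := H b' b'S; have := H' b bS; move: ab ab' bb'; rewrite !ord_neqE /ccw; lia.
Qed.

Lemma dedge_other S a b : 2 < #|S| -> exists2 c, c \in S & (c != a) && (c != b).
Proof.
move=> S2; case: (set_0Vmem (S :\: [set a; b])) => [/eqP|[c]].
  rewrite finset.setD_eq0 => /subset_leq_card; rewrite cards2; case: (a != b); lia.
by rewrite !inE negb_or => /andP[? ?]; exists c.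
Qed.

Lemma dedge_asym S a b : 2 < #|S| -> dedge S a b -> ~~ dedge S b a.
Proof.
move=> /(dedge_other a b)[c cS /andP[ca cb]] /dedgeP[_ _ _ H].
apply/negP => /dedgeP[_ _ _ H']; have := H c cS ca cb; have := H' c cS cb ca.
rewrite /ccw; lia.
Qed.

(** The edge [(b, a)] confines [S] to the arc from [a] to [b], so every other edge spans a shorter
    arc. This makes the descent in [tiling_dissection] terminate. *)
Lemma dedge_gap S a b a' b' : 2 < #|S| -> dedge S b a -> dedge S a' b' ->
  (a', b') != (b, a) -> gap a' b' < gap a b.
Proof.
move=> S2 ba ab' n2; have n1 : ~~ ((a' == a) && (b' == b)).
  by apply: contraTN ab' => /andP[/eqP-> /eqP->]; exact: dedge_asym ba.
have /dedgeP[bS aS nba Hba] := ba; have /dedgeP[a'S b'S nab' Hab'] := ab'.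
move: (Hba a' a'S) (Hba b' b'S) (Hab' a aS) (Hab' b bS) n1 n2 nba nab'.
rewrite xpair_eqE !ord_neqE /ccw /gap.
have := ltn_ord a; have := ltn_ord b; have := ltn_ord a'; have := ltn_ord b'.
clear; case: (leqP a b); case: (leqP a' b'); lia.
Qed.

(** Take for [u] the last vertex of [S] before [x], and for [v] the next vertex of [S] after [u]. *)
Lemma dedge_around S x : 1 < #|S| -> x \notin S -> exists u v, dedge S u v /\ ccw u x v.
Proof.
move=> S1 xS; have /card_gt0P[s sS] : 0 < #|S| by lia.
case: (@arg_minnP _ s (mem S) (gap^~ x)) => // u uS H.
have [v uv] := dedge_next uS S1; exists u, v; split => //.
have /dedgeP[_ vS nuv _] := uv.
have xu : x != u by apply: contraNneq xS => ->.
have xv : x != v by apply: contraNneq xS => ->.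
have := H v vS; move: xu xv nuv; rewrite !ord_neqE /gap /ccw.
have := ltn_ord u; have := ltn_ord v; have := ltn_ord x.
case: (leqP u x); case: (leqP v x); lia.
Qed.

(* The edge of a piece that faces the marked edge. *)
Lemma dedge_root S : 1 < #|S| -> exists a b, [/\ a < b, dedge S b a &
  forall c, c \in S -> a <= c <= b].
Proof.
move=> S1; have /card_gt0P[s sS] : 0 < #|S| by lia.
case: (@arg_maxnP _ s (mem S) val) => //= b bS H.
have [a ba] := dedge_next bS S1; exists a, b; have /dedgeP[_ aS nab Hab] := ba.
have := H a aS; move: nab; rewrite ord_neqE => nab lab; split => //; first lia.
move=> c cS; have := H c cS; have := Hab c cS; rewrite !ord_neqE /ccw; lia.
Qed.

(** The line through an edge of [S] separates the two pieces. Negating [ccw] lets [T] contain [u]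
    and [v] themselves. *)
Definition edge_separated S T :=
  [exists u, exists v, dedge S u v && [forall c in T, ~~ ccw u v c]].

Lemma edge_separatedP S T :
  reflect (exists u v, dedge S u v /\ forall c, c \in T -> ~~ ccw u v c)
          (edge_separated S T).
Proof.
apply: (iffP existsP) => -[u].
  by move=> /existsP[v /andP[uv /forall_inP H]]; exists u, v.
by move=> [v [uv H]]; exists u; apply/existsP; exists v; rewrite uv; apply/forall_inP.
Qed.

(* Two common vertices of separated pieces span the separating edge. *)
Lemma separated_dedge S T a b : 2 < #|S| -> edge_separated S T -> a \in T -> b \in T ->
  dedge S a b -> forall c, c \in T -> ~~ ccw a b c.
Proof.
move=> S2 /edge_separatedP[u [v [uv H]]] aT bT ab.
case: (eqVneq (a, b) (u, v)) => [[-> ->] //|ne].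
have /dedgeP[aS bS nab Hab] := ab; have /dedgeP[_ _ _ Huv] := uv.
have Ha : (a == u) || (a == v).
  by apply: contraR (H a aT); rewrite negb_or => /andP[]; apply: Huv.
have Hb : (b == u) || (b == v).
  by apply: contraR (H b bT); rewrite negb_or => /andP[]; apply: Huv.
case/orP: Ha => /eqP Ha; case/orP: Hb => /eqP Hb; subst.
- by rewrite eqxx in nab.
- by rewrite eqxx in ne.
- by rewrite (negbTE (dedge_asym S2 uv)) in ab.
- by rewrite eqxx in nab.
Qed.

(** Both pieces would lie to the left of the same directed edge. *)
Lemma dedge_unique S T a b : 2 < #|S| -> 2 < #|T| -> edge_separated S T ->
  dedge S a b -> dedge T a b -> False.
Proof.
move=> S2 T2 ST ab /dedgeP[aT bT _ H].
have [c cT /andP[ca cb]] := dedge_other a b T2.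
by have := separated_dedge S2 ST aT bT ab cT; rewrite H.
Qed.

Lemma dedge_flip S T a b : 2 < #|S| -> 2 < #|T| -> edge_separated S T ->
  dedge S a b -> a \in T -> b \in T -> dedge T b a.
Proof.
move=> S2 T2 ST ab aT bT; have H := separated_dedge S2 ST aT bT ab.
have /dedgeP[_ _ nab _] := ab.
apply/dedgeP; split; rewrite 1?eq_sym // => c cT cb ca.
rewrite ccw_rot ccw_or ?H //; by rewrite eq_sym.
Qed.

(** * Rotation of the labels, by addition modulo [N.+2] *)

Definition translate i S := [set (x + i)%R | x in S].

Lemma mem_translate i S x : ((x + i)%R \in translate i S) = (x \in S).
Proof. exact: (mem_imset _ _ (@addIr _ i)). Qed.

Lemma translateK i : cancel (translate i) (translate (- i)%R).
Proof.
move=> S; apply/finset.setP => x; rewrite -{1}(subrK (- i)%R x) mem_translate opprK.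
by rewrite mem_translate.
Qed.

Lemma translate_inj i : injective (translate i).
Proof. exact: can_inj (translateK i). Qed.

Lemma card_translate i S : #|translate i S| = #|S|.
Proof. by exact: (card_imset _ (@addIr _ i)). Qed.

Lemma dedge_translate i S a b :
  dedge (translate i S) (a + i)%R (b + i)%R = dedge S a b.
Proof.
rewrite /dedge !mem_translate (inj_eq (addIr i)); do 3!congr (_ && _).
apply/forall_inP/forall_inP => H c cS.
  rewrite -(ccwD i) H //; move: cS; rewrite !inE mem_translate.
  by rewrite !(inj_eq (addIr i)).
rewrite -(subrK i c) in cS *; rewrite ccwD H //; move: cS; rewrite !inE.
by rewrite mem_translate !(inj_eq (addIr i)).
Qed.

Lemma separated_translate i S T :
  edge_separated S T -> edge_separated (translate i S) (translate i T).
Proof.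
move=> /edge_separatedP[u [v [uv H]]]; apply/edge_separatedP; exists (u + i)%R, (v + i)%R.
rewrite dedge_translate; split=> // c; rewrite -(subrK i c) mem_translate ccwD.
exact: H.
Qed.

End Cyclic.

(** * Combinatorial dissections and their colourings *)

Section Tiling.
Context {N : nat}.
Implicit Types (a b c u v x : 'I_N.+2) (S T U : {set 'I_N.+2}).
Implicit Types (D B : {set {set 'I_N.+2}}).

(** The combinatorial substitute for [is_dissection]. Covering is replaced by the last two fields:
    there is a piece at every boundary edge and one across every other edge of a piece. *)
Record tiling k D : Prop := Tiling {
  tiling_card : forall S, S \in D -> #|S| = k;
  tiling_separated : forall S T, S \in D -> T \in D -> S != T -> edge_separated S T;
  tiling_boundary : forall a, exists2 S, S \in D & dedge S a (a + 1)%R;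
  tiling_inner : forall S a b, S \in D -> dedge S a b -> b != (a + 1)%R ->
    exists2 T, T \in D & dedge T b a }.

(** The marked edge is left out, so that colourings are stable under complement and rotation. *)
Definition coloring D B :=
  B \subset D /\ forall S T a b, S \in D -> T \in D -> dedge S a b -> dedge T b a ->
    (S \in B) != (T \in B).

Lemma coloringC D B : coloring D B -> coloring D (D :\: B).
Proof.
move=> [BD H]; split; first exact: finset.subsetDl.
move=> S T a b SD TD ab ba; rewrite !inE SD TD !andbT (inj_eq negb_inj).
exact: H ab ba.
Qed.

Definition translates i D := [set translate i S | S in D].

Lemma mem_translates i D S : (translate i S \in translates i D) = (S \in D).
Proof. exact: (mem_imset _ _ (@translate_inj _ i)). Qed.

Lemma translatesK i : cancel (translates i) (translates (- i)%R).
Proof.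
move=> D; rewrite /translates -imset_comp -[RHS]imset_id.
exact/eq_imset/translateK.
Qed.

Lemma translates_inj i : injective (translates i).
Proof. exact: can_inj (translatesK i). Qed.

Lemma tiling_translate k i D : tiling k D -> tiling k (translates i D).
Proof.
move=> tD; split.
- by move=> _ /imsetP[S SD ->]; rewrite card_translate (tiling_card tD).
- move=> _ _ /imsetP[S SD ->] /imsetP[T TD ->]; rewrite (inj_eq (@translate_inj _ i)).
  move=> ST; exact/separated_translate/(tiling_separated tD).
- move=> a; have [S SD Sa] := tiling_boundary tD (a - i)%R.
  exists (translate i S); first by rewrite mem_translates.
  by rewrite -(dedge_translate i) [(_ + 1 + i)%R]addrAC !subrK in Sa.
- move=> _ a b /imsetP[S SD ->].
  rewrite -(subrK i a) -(subrK i b) dedge_translate => ab.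
  rewrite [(_ + i + 1)%R]addrAC (inj_eq (addIr i)) => nab.
  have [T TD ba] := tiling_inner tD SD ab nab.
  by exists (translate i T); rewrite ?mem_translates ?dedge_translate.
Qed.

Lemma coloring_translate i D B : coloring D B ->
  coloring (translates i D) (translates i B).
Proof.
move=> [BD H]; split; first exact: imsetS.
move=> _ _ a b /imsetP[S SD ->] /imsetP[T TD ->].
rewrite -(subrK i a) -(subrK i b) !dedge_translate !mem_translates; exact: H.
Qed.

(** * The tree of pieces rooted at the marked edge, and its colourings *)

Section Fixed.
Variables (k : nat) (D : {set {set 'I_N.+2}}).
Hypotheses (k2 : 2 < k) (tD : tiling k D).

Lemma tiling_card_gt2 S : S \in D -> 2 < #|S|.
Proof. by move=> /(tiling_card tD) ->. Qed.

Lemma tiling_dedge_inj S T a b : S \in D -> T \in D ->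
  dedge S a b -> dedge T a b -> S = T.
Proof.
move=> SD TD Sab Tab; apply/eqP/negPn/negP => ST.
have sep := tiling_separated tD SD TD ST.
exact: dedge_unique (tiling_card_gt2 SD) (tiling_card_gt2 TD) sep Sab Tab.
Qed.

Lemma tiling_N_gt0 : 0 < N.
Proof.
have [S SD _] := tiling_boundary tD ord0.
have := leq_trans (tiling_card_gt2 SD) (max_card (mem S)); by rewrite card_ord.
Qed.

(** Cutting the cycle at the marked edge turns labels into a line; this is inclusion of the
    intervals spanned by the pieces. *)
Definition inside S T :=
  [forall c in S, [exists a in T, exists b in T, a <= c <= b]].

Lemma insideP S T :
  reflect (forall c, c \in S ->
      exists a b, [/\ a \in T, b \in T & a <= c <= b]) (inside S T).
Proof.
apply: (iffP forall_inP) => H c cS.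
  by have /exists_inP[a aT /exists_inP[b bT h]] := H c cS; exists a, b.
have [a [b [aT bT h]]] := H c cS; apply/exists_inP; exists a => //.
by apply/exists_inP; exists b.
Qed.

(** [S] counts as its own ancestor, so the piece at the marked edge has one ancestor and comes out
    black. *)
Definition ancestors S := [set T in D | inside S T].

Lemma dedge_root_bounds S a b c : a < b -> dedge S b a -> c \in S -> a <= c <= b.
Proof.
move=> ab /dedgeP[_ _ _ H] cS; move: (H c cS); rewrite !ord_neqE /ccw; lia.
Qed.

(** [T] is the piece across the edge of [S] that faces the marked edge, so it is the parent of [S],
    and the ancestors of [S] are [S] and those of [T]. *)
Lemma card_ancestors_child S T a b : S \in D -> T \in D -> a < b ->
  dedge S b a -> dedge T a b -> #|ancestors S| = #|ancestors T|.+1.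
Proof.
move=> SD TD ab Sba Tab; have /dedgeP[bS aS _ HS] := Sba.
have /dedgeP[aT bT _ HT] := Tab.
suff -> : ancestors S = S |: ancestors T.
  rewrite cardsU1 inE SD /=.
  (* [S] is not an ancestor of [T]: a third vertex of [T] lies beyond the edge, outside the interval
     from [a] to [b]. *)
  case: insideP => // H; have [c cT /andP[ca cb]] := dedge_other a b (tiling_card_gt2 TD).
  have [x [y [xS yS /andP[xc cy]]]] := H c cT; have := HT c cT ca cb.
  have /andP[ax _] := dedge_root_bounds ab Sba xS.
  have /andP[_ yb] := dedge_root_bounds ab Sba yS.
  by rewrite ccw_ltE // ltnNge (leq_trans ax xc) ltnNge (leq_trans cy yb).
apply/finset.setP => U; rewrite !inE; apply/andP/orP.
- move=> [UD /insideP H]; case: (eqVneq U S) => [|US]; [by left|right; rewrite UD /=].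
  apply/insideP => t tT.
  case: (eqVneq U T) => [->|UT]; first by exists t, t; rewrite !leqnn.
  (* If [u < v], then [T] lies between [u] and [v], hence inside [U]. Otherwise [U] lies between [v]
     and [u], and containing [S] forces [(u, v) = (b, a)], so that [U = S]. *)
  have /edge_separatedP[u [v [Uuv Huv]]] := tiling_separated tD UD TD UT.
  have /dedgeP[uU vU nuv HU] := Uuv; move: (Huv t tT) (Huv a aT) (Huv b bT) nuv.
  case: (ltngtP u v) => [uv|vu|/val_inj ->]; last by rewrite eqxx.
    by rewrite ccw_ltE // negb_or -!leqNgt => ht _ _ _; exists u, v.
  rewrite !ccw_gtE // => _ Ha Hb _.
  have [x [x2 [xU _ hx]]] := H a aS.
  have [y1 [y [_ yU hy]]] := H b bS.
  have := dedge_root_bounds vu Uuv xU; have := dedge_root_bounds vu Uuv yU => h1 h2.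
  have Ea : a = v by apply: val_inj => /=; move: hx hy h1 h2 Ha ab; clear; lia.
  have Eb : b = u by apply: val_inj => /=; move: hx hy h1 h2 Hb ab; clear; lia.
  by subst; rewrite (tiling_dedge_inj UD SD Uuv Sba) eqxx in US.
- move=> [/eqP->|/andP[UD /insideP H]].
    by split=> //; apply/insideP => c cS; exists c, c; rewrite !leqnn.
  split=> //; apply/insideP => c cS; have := dedge_root_bounds ab Sba cS.
  have [x [x2 [xU _ hx]]] := H a aT; have [y1 [y [_ yU hy]]] := H b bT => h.
  by exists x, y; split => //; move: h hx hy; clear; lia.
Qed.

(** Another ancestor would also contain both extreme labels and so lie across the marked edge, where
    there are no vertices. *)
Lemma card_ancestors_root S : S \in D -> dedge S ord_max ord0 -> #|ancestors S| = 1.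
Proof.
move=> SD S0; have /dedgeP[mS oS n0 HS] := S0.
suff -> : ancestors S = [set S] by rewrite cards1.
apply/finset.setP => U; rewrite !inE; apply/andP/eqP => [[UD /insideP H]|->]; last first.
  by split=> //; apply/insideP => c cS; exists c, c; rewrite !leqnn.
have oU : ord0 \in U.
  have [x [y [xU _ /andP[h _]]]] := H _ oS; suff <- : x = ord0 by [].
  by apply: val_inj => /=; apply/eqP; rewrite -leqn0.
have mU : ord_max \in U.
  have [y [x [_ xU /andP[_ h]]]] := H _ mS; suff <- : x = ord_max by [].
  by apply: val_inj => /=; apply/eqP; rewrite eqn_leq h -ltnS ltn_ord.
apply/eqP/negPn/negP; rewrite eq_sym => /(tiling_separated tD SD UD) SU.
have := dedge_flip (tiling_card_gt2 SD) (tiling_card_gt2 UD) SU S0 mU oU.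
move=> /dedgeP[_ _ _ HU].
have [c cU /andP[co cm]] := dedge_other ord0 ord_max (tiling_card_gt2 UD).
by have := HU c cU co cm; rewrite ccw_ltE //= ltnNge -ltnS ltn_ord.
Qed.

(* The colour of a piece is the parity of the number of pieces between it and
   the marked edge. *)
Definition canonical_black := [set S in D | odd #|ancestors S|].

(** Crossing an edge changes the number of ancestors by one; the order of [a] and [b] tells which
    piece is the parent. *)
Lemma canonical_coloring : coloring D canonical_black.
Proof.
split; first by apply/fintype.subsetP => S; rewrite inE => /andP[].
move=> S T a b SD TD Sab Tba; rewrite !inE SD TD /=.
have /dedgeP[_ _ nab _] := Sab; case: (ltngtP a b) => [ab|ba|/val_inj E].
- rewrite (card_ancestors_child TD SD ab Tba Sab) /=; by case: odd.
- rewrite (card_ancestors_child SD TD ba Sab Tba) /=; by case: odd.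
- by rewrite E eqxx in nab.
Qed.

Lemma canonical_root S : S \in D -> dedge S ord_max ord0 -> S \in canonical_black.
Proof. by move=> SD S0; rewrite inE SD card_ancestors_root. Qed.

Lemma ordS_ltE a b : a < b -> (a == (b + 1)%R) = (a == ord0) && (b == ord_max).
Proof.
rewrite !ord_neqE ordDE => ab; have /= := ltn_ord b.
rewrite modn_small //; case: (ltnP (b + 1)) => /= h hb; apply/idP/andP; lia.
Qed.

(** Agreement at the piece of the marked edge propagates from parent to child. *)
Lemma coloring_uniq B B' S0 : coloring D B -> coloring D B' ->
  S0 \in D -> dedge S0 ord_max ord0 -> (S0 \in B) = (S0 \in B') -> B = B'.
Proof.
move=> [BD HB] [BD' HB'] S0D S0e E0.
(* The interval spanned by a piece grows strictly towards the root, so the complementary length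
   serves as induction measure. *)
suff H n S a b : S \in D -> a < b -> dedge S b a -> N.+2 - (b - a) < n ->
    (S \in B) = (S \in B').
  apply/finset.setP => S; case: (boolP (S \in D)) => SD; last first.
    by rewrite (contraNF (fintype.subsetP BD S) SD) (contraNF (fintype.subsetP BD' S) SD).
  have [|a [b [ab Sba _]]] := @dedge_root _ S; first exact: ltnW (tiling_card_gt2 SD).
  exact: (H _ S a b SD ab Sba (ltnSn _)).
elim: n => // n IH in S a b * => SD ab Sba hn.
case: (boolP (a == (b + 1)%R)) => Eab.
  move: Eab; rewrite ordS_ltE // => /andP[/eqP ? /eqP ?]; subst.
  by rewrite (tiling_dedge_inj SD S0D Sba S0e).
have [T TD Tab] := tiling_inner tD SD Sba Eab.
have T2 := tiling_card_gt2 TD.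
have [a' [b' [ab' Tba' HT]]] := dedge_root (ltnW T2).
have ET : (T \in B) = (T \in B').
  apply: IH TD ab' Tba' _; have /dedgeP[aT bT _ H] := Tab.
  have [c cT /andP[ca cb]] := dedge_other a b T2; have := H c cT ca cb.
  rewrite ccw_ltE //; have := HT a aT; have := HT b bT; have := HT c cT.
  have := ltn_ord b'; clear -hn ab; lia.
have := HB S T b a SD TD Sba Tab; have := HB' S T b a SD TD Sba Tab.
by rewrite ET; case: (T \in B'); do 2!case: (S \in _).
Qed.

(** * Signs of pieces and of boundary edges *)

Local Open Scope ring_scope.

Definition sgc B S : int := if S \in B then 1 else - 1.

(** In a tiling this sum has exactly one term; summing avoids having to choose the piece. *)
Definition boundary_sign B a : int := \sum_(S in D | dedge S a (a + 1)) sgc B S.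

Lemma boundary_signE B S a : S \in D -> dedge S a (a + 1) -> boundary_sign B a = sgc B S.
Proof.
move=> SD Sa; rewrite /boundary_sign (big_pred1 S) // => T /=.
apply/andP/eqP => [[TD Ta]|->] //; exact: tiling_dedge_inj Ta Sa.
Qed.

Lemma sum_sgc B : B \subset D -> \sum_(S in D) sgc B S = #|B|%:Z - #|D :\: B|%:Z.
Proof.
move=> BD; rewrite (big_setID B) /= (finset.setIidPr BD).
rewrite (eq_bigr (fun=> 1)); last by rewrite /sgc => S ->.
rewrite [X in _ + X](eq_bigr (fun=> - 1)); last first.
  by move=> S; rewrite inE /sgc => /andP[/negbTE->].
by rewrite !sumr_const mulNrn !natz.
Qed.

Lemma sum_dedge S : (1 < #|S|)%N -> \sum_a \sum_(b | dedge S a b) 1 = #|S|%:Z :> int.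
Proof.
move=> S1; rewrite -natz -sumr_const [RHS]big_mkcond /=; apply: eq_bigr => a _.
case: ifPn => aS; last by rewrite big_pred0 // => b; apply: contraNF aS => /dedgeP[].
have [b ab] := dedge_next aS S1; rewrite (big_pred1 b) // => c.
by apply/idP/eqP => [/(dedge_inj ab)|->].
Qed.

(** Each piece spreads its sign over its [k] directed edges. The two directions of a diagonal carry
    opposite signs, so only boundary edges survive. *)
Lemma sum_boundary_sign B : coloring D B ->
  k%:Z * \sum_(S in D) sgc B S = \sum_a boundary_sign B a.
Proof.
move=> [BD HB].
pose g a b : int := \sum_(S in D | dedge S a b) sgc B S.
have -> : k%:Z * \sum_(S in D) sgc B S = \sum_a \sum_b g a b.
  rewrite mulr_sumr (eq_bigr (fun S => \sum_a \sum_(b | dedge S a b) sgc B S)).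
    rewrite exchange_big; apply: eq_bigr => a _ /=.
    rewrite /g; under [RHS]eq_bigr do rewrite big_mkcondr.
    rewrite [RHS]exchange_big; apply: eq_bigr => S SD /=.
    by rewrite big_mkcond.
  move=> S SD; rewrite -(tiling_card tD SD) -sum_dedge ?(ltnW (tiling_card_gt2 SD)) //.
  rewrite mulr_suml; apply: eq_bigr => a _; rewrite mulr_suml.
  by apply: eq_bigr => b _; rewrite mul1r.
(* With at least three labels, a pair cannot be a boundary edge in both directions. *)
have Nsucc a b : a = b + 1 -> b != a + 1.
  move=> ->; rewrite !ord_neqE !ordDE /=; have := ltn_ord b; have := tiling_N_gt0.
  rewrite modn_small //; case: (ltnP (b + 1)) => /= h N0 hb; case: ifP;
    move: h N0 hb; clear; lia.
have gE a b : g a b + g b a =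
    (if b == a + 1 then boundary_sign B a else 0) +
    (if a == b + 1 then boundary_sign B b else 0).
  (* A piece to the left of a reversed boundary edge would need a label strictly between [a'] and
     [a' + 1]. *)
  have g0 a' b' : b' = a' + 1 -> g b' a' = 0.
    move=> E; rewrite /g big_pred0 // => S; apply/negP => /andP[SD Sba].
    have [T TD Tab] := tiling_boundary tD a'; rewrite -E in Tab.
    have /dedgeP[bS aS _ HS] := Sba; have S2 := tiling_card_gt2 SD.
    have [c cS /andP[ca cb]] := dedge_other a' b' S2; have := HS c cS cb ca; move: ca cb.
    rewrite !ord_neqE E /ccw ordDE /= modn_small //.
    have := ltn_ord c; have := ltn_ord a'.
    case: (ltnP (a' + 1)) => /=; lia.
  case: eqVneq => [E|nb].
    by rewrite [g b a]g0 // (negbTE (contraTneq (@Nsucc _ _) _)) ?E ?eqxx // ; rewrite E.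
  case: eqVneq => [E|na]; first by rewrite [g a b]g0 // E add0r.
  have gab a' b' S : S \in D -> dedge S a' b' -> g a' b' = sgc B S.
    move=> SD Sab; rewrite /g (big_pred1 S) // => T /=.
    by apply/andP/eqP => [[TD Ta]|->] //; exact: tiling_dedge_inj Ta Sab.
  have opp a' b' S : b' != a' + 1 -> S \in D -> dedge S a' b' -> g a' b' + g b' a' = 0.
    move=> nab SD Sab; have [T TD Tba] := tiling_inner tD SD Sab nab.
    rewrite (gab _ _ _ SD Sab) (gab _ _ _ TD Tba); have := HB S T a' b' SD TD Sab Tba.
    by rewrite /sgc; do 2!case: (_ \in B).
  rewrite addr0; case: (pickP (fun S => (S \in D) && dedge S a b)) => [S /andP[SD]|H1].
    exact: opp.
  case: (pickP (fun S => (S \in D) && dedge S b a)) => [S /andP[SD Sba]|H2].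
    rewrite addrC; exact: opp Sba.
  by rewrite /g !big_pred0.
(* Doubling allows each ordered pair to be grouped with its reverse. *)
suff : 2 * \sum_a \sum_b g a b = 2 * \sum_a boundary_sign B a.
  by apply: mulfI.
rewrite !mulr_natl !mulr2n {2}exchange_big -!big_split /=.
under eq_bigr => a _ do rewrite -big_split /=.
under eq_bigr => a _ do under eq_bigr => b _ do rewrite gE.
under eq_bigr => a _ do rewrite big_split /=.
rewrite big_split /= [X in _ + X]exchange_big /= -big_split /=; apply: eq_bigr => a _.
by congr (_ + _); rewrite -big_mkcond big_pred1_eq.
Qed.

End Fixed.
End Tiling.

(** * Hulls and orientation *)

Local Open Scope ring_scope.

Section Points.
Context {R : realType}.
Implicit Types (a b c q x : R * R) (t : R).

Lemma orientN a b c : orient b a c = - orient a b c.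
Proof. by rewrite /orient; ring. Qed.

Lemma orient_rot a b c : orient a b c = orient b c a.
Proof. by rewrite /orient; ring. Qed.

Lemma orient_aab a b : orient a b a = 0.
Proof. by rewrite /orient; ring. Qed.

Lemma orient_abb a b : orient a b b = 0.
Proof. by rewrite /orient; ring. Qed.

Definition segment a b t : R * R := (a.1 + t * (b.1 - a.1), a.2 + t * (b.2 - a.2)).

Lemma orient_segment a b x c t :
  orient a b (segment x c t) = orient a b x + t * (orient a b c - orient a b x).
Proof. by rewrite /orient /segment /=; ring. Qed.

(** A pair stands for the affine function [q.1 + t * q.2]: finitely many strict inequalities at
    [t = 0] persist for small [t]. *)
Lemma perturb_gt0 (s : seq (R * R)) : all (fun q => 0 < q.1) s ->
  exists t, 0 < t < 1 /\ all (fun q => 0 < q.1 + t * q.2) s.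
Proof.
move=> s0; suff [t0 t01 H] : exists2 t0, 0 < t0 < 1 &
    forall t, 0 < t <= t0 -> all (fun q => 0 < q.1 + t * q.2) s.
  by exists t0; split=> //; apply: H; case/andP: t01 => -> _; rewrite lexx.
elim: s s0 => [_|[c e] s IH /= /andP[c0 /IH[t0 /andP[t00 t01] H]]].
  by exists (1 / 2) => //; lra.
have e0 := normr_ge0 e.
(* For [t] up to this bound, [c + t * e] is at least [t]; the [1 +] guards against [e = 0]. *)
have d0 : 0 < c / (1 + `|e|) by rewrite divr_gt0 //; lra.
exists (Num.min t0 (c / (1 + `|e|))).
  by rewrite lt_min t00 d0 gt_min t01.
move=> t /andP[tt0]; rewrite le_min => /andP[tt tc]; rewrite H ?tt0 ?tt // andbT.
have : t * (1 + `|e|) <= c by rewrite -ler_pdivlMr //; lra.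
have : - `|e| <= e by rewrite lerNl -normrN ler_norm.
nra.
Qed.

Lemma orient_continuous a b : continuous (orient a b).
Proof.
move=> x; rewrite /orient; apply: cvgB; apply: cvgM; try exact: cvg_cst.
  by apply: cvgB; [exact: cvg_snd|exact: cvg_cst].
by apply: cvgB; [exact: cvg_fst|exact: cvg_cst].
Qed.

Lemma near_orient_gt0 a b q : 0 < orient a b q -> \forall x \near q, 0 < orient a b x.
Proof. by move: (orient_continuous (a := a) (b := b) (x := q)) => /cvgr_gt; apply. Qed.

Lemma nbhs_segment (A : set (R * R)) q c : nbhs q A ->
  exists2 t, 0 < t < 1 & A (segment q c t).
Proof.
move=> qA; have f0 : segment q c 0 = q.
  by case: q {qA} => q1 q2; rewrite /segment /=; congr pair; ring.
have cf : (segment q c t @[t --> (0 : R)] --> segment q c 0)%classic.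
  have H (u v : R) : (u + t * v @[t --> (0 : R)] --> u + 0 * v)%classic.
    by apply: cvgD; [exact: cvg_cst|apply: cvgM; [exact: cvg_id|exact: cvg_cst]].
  exact: (cvg_pair (H q.1 (c.1 - q.1)) (H q.2 (c.2 - q.2))).
have := cf A; rewrite f0 => /(_ qA) /nbhs_ballP[e /= e0 He].
exists (Num.min (e / 2) (1 / 2)).
  rewrite lt_min gt_min; lra.
apply: He; rewrite /ball /= sub0r normrN ger0_norm ?gt_min; first by lra.
by rewrite le_min; lra.
Qed.

End Points.

Section Hull.
Context {R : realType} {N : nat} (p : 'I_N -> R * R).
Implicit Types (i j k : 'I_N) (S T : {set 'I_N}) (q x : R * R).

Lemma orient_sum (l : 'I_N -> R) a b x : \sum_i l i = 1 ->
  x.1 = \sum_i l i * (p i).1 -> x.2 = \sum_i l i * (p i).2 ->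
  orient a b x = \sum_i l i * orient a b (p i).
Proof.
move=> l1 x1 x2.
(* The constant term is multiplied by [\sum_i l i = 1], which makes the expression linear in [l]. *)
transitivity ((b.1 - a.1) * (\sum_i l i * (p i).2) - (b.2 - a.2) * (\sum_i l i * (p i).1)
   - (\sum_i l i) * ((b.1 - a.1) * a.2 - (b.2 - a.2) * a.1)).
  by rewrite -x1 -x2 l1 /orient; ring.
rewrite !mulr_sumr mulr_suml -!sumrB; apply: eq_bigr => i _.
by rewrite /orient; ring.
Qed.

Lemma hull_orient_ge0 S a b x : hull p S x ->
  (forall i, i \in S -> 0 <= orient a b (p i)) -> 0 <= orient a b x.
Proof.
move=> [l [l0 lS l1 x1 x2]] H; rewrite (orient_sum a b l1 x1 x2).
apply: sumr_ge0 => i _; case: (boolP (i \in S)) => iS; first by rewrite mulr_ge0 ?H.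
by rewrite lS // mul0r.
Qed.

Lemma hullS S T x : S \subset T -> hull p S x -> hull p T x.
Proof.
move=> /fintype.subsetP ST [l [l0 lS l1 x1 x2]]; exists l; split => // i iT.
by apply: lS; apply: contra iT; apply: ST.
Qed.

Lemma sum_delta k (f : 'I_N -> R) : \sum_i (i == k)%:R * f i = f k.
Proof.
by rewrite (bigD1 k) //= eqxx mul1r big1 ?addr0 // => i /negbTE->; rewrite mul0r.
Qed.

Lemma hull_vertex S k : k \in S -> hull p S (p k).
Proof.
move=> kS; exists (fun i => (i == k)%:R); split; rewrite ?sum_delta //.
- by move=> i iS; have /negbTE-> : i != k by apply: contraNneq iS => ->.
- by rewrite (bigD1 k) //= eqxx big1 ?addr0 // => i /negbTE->.
Qed.

Lemma hull_segment S x k t : hull p S x -> k \in S -> 0 <= t <= 1 ->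
  hull p S (segment x (p k) t).
Proof.
move=> [l [l0 lS l1 x1 x2]] kS /andP[t0 t1].
have sumE (f : 'I_N -> R) : \sum_i ((1 - t) * l i + t * (i == k)%:R) * f i
    = (1 - t) * (\sum_i l i * f i) + t * f k.
  under eq_bigr do rewrite mulrDl -!mulrA.
  by rewrite big_split /= -!mulr_sumr sum_delta.
exists (fun i => (1 - t) * l i + t * (i == k)%:R); split.
- by move=> i; rewrite addr_ge0 // mulr_ge0 // subr_ge0.
- move=> i iS; have /negbTE-> : i != k by apply: contraNneq iS => ->.
  by rewrite lS // !mulr0 addr0.
- rewrite -[LHS]mulr1 mulr_suml sumE -mulr_suml l1; ring.
- by rewrite sumE -x1 /segment /=; ring.
- by rewrite sumE -x2 /segment /=; ring.
Qed.

(** The barycentric coordinates of [q] are ratios of signed areas. *)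
Lemma hull_triangle S i j k q : i \in S -> j \in S -> k \in S ->
  0 < orient (p i) (p j) (p k) -> 0 <= orient (p i) (p j) q ->
  0 <= orient (p j) (p k) q -> 0 <= orient (p k) (p i) q -> hull p S q.
Proof.
move=> iS jS kS; set d := orient (p i) (p j) (p k) => d0 hij hjk hki.
have sumE (u v w : R) (f : 'I_N -> R) :
  \sum_h ((h == i)%:R * u + (h == j)%:R * v + (h == k)%:R * w) * f h
    = u * f i + v * f j + w * f k.
  under eq_bigr do rewrite !mulrDl -!mulrA.
  by rewrite !big_split /= !(sum_delta _ (fun h => _ * f h)).
exists (fun h => (h == i)%:R * (orient (p j) (p k) q / d)
  + (h == j)%:R * (orient (p k) (p i) q / d) + (h == k)%:R * (orient (p i) (p j) q / d)).
split.
- by move=> h; rewrite !addr_ge0 // mulr_ge0 ?ler0n // divr_ge0 // ltW.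
- move=> h hS; have /negbTE-> : h != i by apply: contraNneq hS => ->.
  have /negbTE-> : h != j by apply: contraNneq hS => ->.
  have /negbTE-> : h != k by apply: contraNneq hS => ->.
  by rewrite !mul0r !addr0.
- rewrite -[LHS]mulr1 mulr_suml.
  by rewrite sumE; move: d0; rewrite /d /orient => d0; field; rewrite gt_eqF.
- by rewrite sumE; move: d0; rewrite /d /orient => d0; field; rewrite gt_eqF.
- by rewrite sumE; move: d0; rewrite /d /orient => d0; field; rewrite gt_eqF.
Qed.

Lemma interior_triangle S i j k q : i \in S -> j \in S -> k \in S ->
  0 < orient (p i) (p j) (p k) -> 0 < orient (p i) (p j) q ->
  0 < orient (p j) (p k) q -> 0 < orient (p k) (p i) q -> interior (hull p S) q.
Proof.
move=> iS jS kS d0 /near_orient_gt0 hij /near_orient_gt0 hjk /near_orient_gt0 hki.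
rewrite /interior /=; near=> x; apply: (hull_triangle iS jS kS d0).
all: apply: ltW; near: x => //.
Unshelve. all: by end_near.
Qed.

(* The moved point leaves the crossing [z] of the chords [u v] and [x y]
   towards an end of each chord. *)
Lemma crossing_overlap S T (u v s x y t e w : 'I_N) z : u \in S -> v \in S -> s \in S ->
  x \in T -> y \in T -> t \in T ->
  0 < orient (p u) (p v) (p s) -> 0 < orient (p x) (p y) (p t) ->
  0 < orient (p u) (p v) (p e) -> 0 < orient (p x) (p y) (p w) ->
  orient (p u) (p v) (p w) = 0 -> orient (p x) (p y) (p e) = 0 ->
  orient (p u) (p v) z = 0 -> 0 < orient (p v) (p s) z -> 0 < orient (p s) (p u) z ->
  orient (p x) (p y) z = 0 -> 0 < orient (p y) (p t) z -> 0 < orient (p t) (p x) z ->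
  ~ nonoverlapping (hull p S) (hull p T).
Proof.
move=> uS vS sS xT yT tT uvs xyt uve xyw uvw xye uvz vsz suz xyz ytz txz.
(* The derivative of [orient (p i) (p j)] along the motion [p e + p w - 2 z]. It is positive for
   both chords, as each contains [z] and one of the two ends and has the other end on its left. *)
pose m i j := orient (p i) (p j) (p e) + orient (p i) (p j) (p w)
  - 2 * orient (p i) (p j) z.
have [|h [/andP[h0 _]]] := @perturb_gt0 _ [:: (orient (p v) (p s) z, m v s);
  (orient (p s) (p u) z, m s u); (orient (p y) (p t) z, m y t);
  (orient (p t) (p x) z, m t x)].
  by rewrite /= vsz suz ytz txz.
pose q := (z.1 + h * ((p e).1 + (p w).1 - 2 * z.1),
  z.2 + h * ((p e).2 + (p w).2 - 2 * z.2)).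
have qE i j : orient (p i) (p j) q = orient (p i) (p j) z + h * m i j.
  by rewrite /m /q /orient /=; ring.
rewrite /= -!qE andbT => /and4P[q1 q2 q3 q4].
rewrite /nonoverlapping => /(congr1 (fun A : set _ => A q)); rewrite /setI /=.
move=> E; suff : False by [].
rewrite -E; split.
  by apply: (interior_triangle uS vS sS) => //; rewrite qE /m uvz uvw; nra.
by apply: (interior_triangle xT yT tT) => //; rewrite qE /m xyz xye; nra.
Qed.

End Hull.

(** * Geometric dissections of a strictly convex polygon are the tilings *)

Section ConvexPolygon.
Context {R : realType} {N : nat} (p : 'I_N.+2 -> R * R) (hp : strictly_convex p).
Implicit Types (a b c u v : 'I_N.+2) (S T : {set 'I_N.+2}) (q x : R * R).
Implicit Types (D : {set {set 'I_N.+2}}).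

Local Notation o a b := (orient (p a) (p b)).

Lemma ccw_orient a b c : ccw a b c -> 0 < o a b (p c).
Proof.
case/or3P => h; [|rewrite orient_rot|rewrite -orient_rot]; exact: hp.
Qed.

(** For the converse, distinct labels in the wrong cyclic order form a negatively oriented
    triangle. *)
Lemma orient_gt0 a b c : (0 < o a b (p c)) = ccw a b c.
Proof.
apply/idP/idP => [|/ccw_orient//]; apply: contraTT => abc.
case: (eqVneq a b) => [<-|ab]; first by rewrite orient_rot orient_aab ltxx.
case: (eqVneq a c) => [<-|ac]; first by rewrite orient_aab ltxx.
case: (eqVneq b c) => [<-|bc]; first by rewrite orient_abb ltxx.
have := ccw_orient (ccw_or ab ac bc abc).
rewrite -leNgt orient_rot orientN -orient_rot; lra.
Qed.

Lemma orient_le0 a b c : (o a b (p c) <= 0) = ~~ ccw a b c.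
Proof. by rewrite leNgt orient_gt0. Qed.

Lemma dedge_orient S a b c : dedge S a b -> c \in S -> 0 <= o a b (p c).
Proof.
move=> /dedgeP[_ _ _ H] cS; case: (eqVneq c a) => [->|ca]; first by rewrite orient_aab.
case: (eqVneq c b) => [->|cb]; first by rewrite orient_abb.
by rewrite ltW // ccw_orient // H.
Qed.

(** Cut [S] into a fan of triangles at a vertex [s]. With [v] the last vertex such that [q] is not
    to the right of the ray from [s] to [v], and [w] the next one, [q] lies in the triangle
    [v w s]. *)
Lemma hull_halfplanes S q : (2 < #|S|)%N ->
  (forall a b, dedge S a b -> 0 <= o a b q) -> hull p S q.
Proof.
move=> S2 H; have /card_gt0P[s sS] : (0 < #|S|)%N by lia.
have [f sf] := dedge_next sS (ltnW S2); have /dedgeP[_ fS _ _] := sf.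
pose P v := [&& v \in S, v != s, ~~ dedge S v s & 0 <= o s v q].
have Pf : P f.
  by have /dedgeP[_ _ sf' _] := sf; rewrite /P fS eq_sym sf' dedge_asym //= H.
case: (arg_maxnP (gap s) Pf) => v /and4P[vS vs nvs sv] vmax.
have [w vw] := dedge_next vS (ltnW S2); have /dedgeP[_ wS nvw Hvw] := vw.
have ws : w != s by apply: contraNneq nvs => <-.
have vws : ccw v w s by apply: Hvw; rewrite // eq_sym.
apply: (hull_triangle vS wS sS _ (H _ _ vw)) => //; first exact: ccw_orient.
case: (boolP (dedge S w s)) => [/H//|nws].
rewrite leNgt; apply/negP => sw; have : P w.
  rewrite /P wS ws nws /=; move: sw; rewrite orientN; lra.
by move=> /vmax /=; apply/negP; rewrite -ltnNge gap_lt // ccw_rot.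
Qed.

Lemma centroid_interior S a b c : a \in S -> b \in S -> c \in S -> ccw a b c ->
  interior (hull p S) (((p a).1 + (p b).1 + (p c).1) / 3,
    ((p a).2 + (p b).2 + (p c).2) / 3).
Proof.
move=> aS bS cS /ccw_orient abc; apply: (interior_triangle aS bS cS) => //.
all: move: abc; rewrite /orient /=; lra.
Qed.

(** Suppose that no edge of [S] separates. If [T] is a subset of [S], a triangle of [T] gives a
    common interior point. Otherwise a vertex [x] of [T] lies beyond an edge [u v] of [S], some
    vertex [y] of [T] lies on the other side, and the chords [u v] and [x y] cross. *)
Lemma nonoverlapping_separated S T : (2 < #|S|)%N -> (2 < #|T|)%N ->
  nonoverlapping (hull p S) (hull p T) -> edge_separated S T.
Proof.
move=> S2 T2 ST; apply: contrapT => nsep.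
have H u v : dedge S u v -> exists2 c, c \in T & ccw u v c.
  move=> uv; apply: contrapT => nc; case: nsep; apply/edge_separatedP.
  by exists u, v; split => // c cT; apply/negP => cc; apply: nc; exists c.
case: (boolP (T \subset S)) => [/fintype.subsetP TS|/fintype.subsetPn[x xT xS]].
  have /card_gt0P[a aT] : (0 < #|T|)%N by lia.
  have [b ab] := dedge_next aT (ltnW T2); have /dedgeP[_ bT _ Hab] := ab.
  have [c cT /andP[ca cb]] := dedge_other a b T2; have abc := Hab c cT ca cb.
  move: ST; rewrite /nonoverlapping => /seteqP[E _]; apply: (E _ (conj _ _)).
    by apply: (centroid_interior _ _ _ abc); apply: TS.
  exact: (centroid_interior _ _ _ abc).
have [u [v [uv uxv]]] := dedge_around (ltnW S2) xS.
have [y yT uvy] := H u v uv; have /dedgeP[uS vS _ Huv] := uv.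
have [s sS /andP[su sv]] := dedge_other u v S2; have uvs := Huv s sS su sv.
have [t tT /andP[tx ty]] := dedge_other x y T2.
have xyu : ccw x y u by move: uxv uvy; rewrite /ccw; clear; lia.
have yxv : ccw y x v by move: uxv uvy; rewrite /ccw; clear; lia.
have xuy : ccw x v y by move: uxv uvy; rewrite /ccw; clear; lia.
have uxy : ccw u x y by move: uxv uvy; rewrite /ccw; clear; lia.
move: (ccw_orient xyu) (ccw_orient yxv) (ccw_orient xuy) (ccw_orient uxy)
  (ccw_orient uxv) (ccw_orient uvy) (ccw_orient uvs).
set A := o x v (p y); set B := o u x (p y) => hxyu hyxv hA hB huxv huvy huvs.
(* The crossing point, with the areas cut off by [x y] as weights on [u v]; [zxy] expresses the same
   point on [x y]. *)
pose z : R * R := ((A * (p u).1 + B * (p v).1) / (A + B),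
  (A * (p u).2 + B * (p v).2) / (A + B)).
have AB : 0 < A + B by rewrite addr_gt0.
have zuv (a b : R * R) : (A + B) * orient a b z
    = A * orient a b (p u) + B * orient a b (p v).
  by rewrite /z /orient /=; field; rewrite gt_eqF.
have zxy (a b : R * R) : (A + B) * orient a b z
    = o u v (p y) * orient a b (p x) + o u x (p v) * orient a b (p y).
  by rewrite zuv /A /B /orient; ring.
have pos (a b : R * R) : 0 < (A + B) * orient a b z -> 0 < orient a b z.
  by rewrite pmulr_rgt0.
have zer (a b : R * R) : (A + B) * orient a b z = 0 -> orient a b z = 0.
  by move=> /eqP; rewrite mulf_eq0 gt_eqF //= => /eqP.
have uvz : o u v z = 0 by apply: zer; rewrite zuv orient_aab orient_abb !mulr0 addr0.
have vsz : 0 < o v s z.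
  by apply: pos; rewrite zuv -orient_rot orient_aab mulr0 addr0 mulr_gt0.
have suz : 0 < o s u z.
  by apply: pos; rewrite zuv orient_abb mulr0 add0r orient_rot mulr_gt0.
have xyz : o x y z = 0 by apply: zer; rewrite zxy orient_aab orient_abb !mulr0 addr0.
have yxz : o y x z = 0 by rewrite orientN xyz oppr0.
(* The chord [x y] is directed so that [t] is on its left; the end of [u v] on that side is [u] or
   [v] accordingly. *)
case: (boolP (ccw x y t)) => [xyt|nxyt].
- have := ccw_orient xyt => hxyt.
  apply: (@crossing_overlap _ _ p S T u v s x y t y u z) ST => //.
  + exact: orient_aab.
  + exact: orient_abb.
  + by apply: pos; rewrite zxy orient_aab mulr0 addr0 mulr_gt0 // -orient_rot.
  + by apply: pos; rewrite zxy orient_abb mulr0 add0r mulr_gt0 // orient_rot.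
have xy : x != y by apply: contraTneq xyu => ->; rewrite /ccw; clear; lia.
have yxt : ccw y x t by rewrite ccw_rot; apply: ccw_or; rewrite // eq_sym.
have := ccw_orient yxt => hyxt.
apply: (@crossing_overlap _ _ p S T u v s y x t y v z) ST => //.
+ exact: orient_abb.
+ exact: orient_aab.
+ by apply: pos; rewrite zxy orient_aab mulr0 add0r mulr_gt0 // -orient_rot.
+ by apply: pos; rewrite zxy orient_abb mulr0 addr0 mulr_gt0 // orient_rot.
Qed.

(** A common interior point would lie on the separating line, and moving it slightly towards a
    vertex of [S] off that line would leave the hull of [T]. *)
Lemma separated_nonoverlapping S T : (2 < #|S|)%N -> edge_separated S T ->
  nonoverlapping (hull p S) (hull p T).
Proof.
move=> S2 /edge_separatedP[u [v [uv H]]]; apply/seteqP; split => // x [xS xT].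
have [w wS /andP[wu wv]] := dedge_other u v S2.
have /dedgeP[_ _ _ Huv] := uv; have uvw := ccw_orient (Huv w wS wu wv).
have HT y : hull p T y -> o u v y <= 0.
  move=> hy; have := @hull_orient_ge0 _ _ p T (p v) (p u) y hy.
  rewrite orientN oppr_ge0; apply => i iT; rewrite orientN oppr_ge0 orient_le0; exact: H.
have [t /andP[t0 _] [yS yT]] := nbhs_segment (p w) (filterI xS xT).
have := HT _ yT; have := hull_orient_ge0 (nbhs_singleton xS) (fun c => dedge_orient uv).
have := HT _ (nbhs_singleton xT); rewrite orient_segment; nra.
Qed.

(** Since [orient] vanishes at the midpoint and is positive at the other vertices of [S], only [a]
    and [b] carry weight. A third vertex [c] shows that both weights are 1/2, so both are in [S]. *)
Lemma midpoint_mem S a b q : (0 < N)%N -> a != b ->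
  q = segment (p a) (p b) (1 / 2) -> hull p S q ->
  (forall c, c \in S -> c != a -> c != b -> ccw a b c) -> dedge S a b.
Proof.
move=> N0 ab qE [l [l0 lS l1 q1 q2]] H.
have E := orient_sum (p a) (p b) l1 q1 q2.
have supp c : c != a -> c != b -> l c = 0.
  move=> ca cb; case: (boolP (c \in S)) => [cS|/lS//].
  have : \sum_i l i * o a b (p i) = 0.
    by rewrite -E qE orient_segment orient_aab orient_abb; ring.
  move=> /eqP; rewrite psumr_eq0 => [/allP/(_ c)|i _].
    rewrite mem_index_enum mulf_eq0 => /(_ isT) /orP[/eqP//|].
    by rewrite gt_eqF // ccw_orient // H.
  case: (boolP (i \in S)) => [iS|/lS->]; last by rewrite mul0r.
  rewrite mulr_ge0 //; case: (eqVneq i a) => [->|ia]; first by rewrite orient_aab.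
  case: (eqVneq i b) => [->|ib]; first by rewrite orient_abb.
  by rewrite ltW // ccw_orient // H.
have sumE (f : 'I_N.+2 -> R) : \sum_i l i * f i = l a * f a + l b * f b.
  rewrite (bigD1 a) //= (bigD1 b) 1?eq_sym //= big1 ?addr0 // => c /andP[ca cb].
  by rewrite supp ?mul0r.
have lab : l a + l b = 1.
  by rewrite -l1; under [RHS]eq_bigr do rewrite -[l _]mulr1; rewrite sumE !mulr1.
have [|c _ /andP[ca cb]] := @dedge_other _ [set: 'I_N.+2]%SET a b.
  by rewrite cardsT card_ord.
have bca : o b c (p a) != 0.
  have [/ccw_orient|h] := boolP (ccw b c a); first by rewrite lt0r => /andP[].
  have /ccw_orient : ccw b a c by apply: ccw_or; rewrite // eq_sym.
  by move=> h2; rewrite orientN oppr_eq0 orient_rot gt_eqF.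
have la : l a = 1 / 2.
  have := orient_sum (p b) (p c) l1 q1 q2; rewrite sumE qE orient_segment orient_aab.
  by move=> h; apply: (mulIf bca); move: h; lra.
have mem_l c' : l c' != 0 -> c' \in S by apply: contraNT => /lS->.
apply/dedgeP; split => //; apply: mem_l; rewrite ?la; apply/eqP; lra.
Qed.

(** The piece at a boundary edge is one containing its midpoint. Across a diagonal, the piece is
    found from a point just beyond the midpoint. *)
Lemma dissection_tiling k m D : (2 < k)%N -> (0 < N)%N ->
  is_dissection p k m D -> tiling k D.
Proof.
move=> k2 N0 [Dm Dk Dn Dh].
have D2 S : S \in D -> (2 < #|S|)%N by move=> /Dk->.
have Dsep S T : S \in D -> T \in D -> S != T -> edge_separated S T.
  by move=> SD TD /eqP ST; apply: nonoverlapping_separated; rewrite ?D2 //; exact: Dn.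
have cover x : hull p [set: 'I_N.+2]%SET x -> exists2 S, S \in D & hull p S x.
  by rewrite -Dh => -[S SD Sx]; exists S.
split => //.
- move=> a; have [|S SD Sm] := cover (segment (p a) (p (a + 1)%R) (1 / 2)).
    by apply: hull_segment; rewrite ?inE //; [apply: hull_vertex; rewrite inE|lra].
  have na : a != (a + 1)%R.
    rewrite !ord_neqE ordDE /= modn_small //; case: ifP; have := ltn_ord a; clear; lia.
  exists S => //; apply: midpoint_mem Sm _ => // c _.
  rewrite !ord_neqE /ccw ordDE /= modn_small //.
  have := ltn_ord a; have := ltn_ord c; case: ifP; clear; lia.
move=> S a b SD Sab nb; have /dedgeP[aS bS ab HS] := Sab.
have ba : b != a by rewrite eq_sym.
pose q := segment (p a) (p b) (1 / 2).
(* As [b] is not [a + 1], the label [a + 1] lies strictly beyond the diagonal. *)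
have [c bac] : exists c, ccw b a c.
  exists (a + 1)%R; move: ab nb; rewrite !ord_neqE /ccw ordDE /= modn_small //.
  have := ltn_ord a; have := ltn_ord b; case: ifP; clear; lia.
(* The points of the segment from the midpoint of [a b] towards [c] are, near
   the midpoint, in no piece that avoids the midpoint. *)
pose bad := [seq (- o i.1.2 i.2 q, - (o i.1.2 i.2 (p c) - o i.1.2 i.2 q)) |
  i <- enum {: {set 'I_N.+2} * 'I_N.+2 * 'I_N.+2} &
    dedge i.1.1 i.1.2 i.2 && (o i.1.2 i.2 q < 0)].
have [|t [/andP[t0 t1] /allP Ht]] := @perturb_gt0 R bad.
  by apply/allP => _ /mapP[i + ->] /=; rewrite mem_filter oppr_gt0 => /andP[/andP[]].
pose x := segment q (p c) t.
have [|T TD Tx] := cover x.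
  apply: hull_segment; rewrite ?inE //; last by rewrite !ltW.
  by apply: hull_segment; rewrite ?inE //; [apply: hull_vertex; rewrite inE|lra].
(* An edge of [T] with [q] strictly on its right would, by the choice of [t], also have [x]
   there. *)
have Tq : hull p T q.
  apply: hull_halfplanes; first exact: D2.
  move=> u v uv; rewrite leNgt; apply/negP => quv.
  have := hull_orient_ge0 Tx (fun c => dedge_orient uv); rewrite orient_segment.
  have /= := Ht (_, _) (map_f _ (_ : (T, u, v) \in _)).
  rewrite mem_filter /= uv quv mem_enum.
  move=> /(_ isT); lra.
have oq u v : o u v q = 1 / 2 * (o u v (p a) + o u v (p b)).
  by rewrite orient_segment; lra.
have ST : S != T.
  apply/eqP => ST; rewrite -ST in Tx.
  have := hull_orient_ge0 Tx (fun c => dedge_orient Sab).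
  rewrite orient_segment oq orient_aab orient_abb; have := ccw_orient bac.
  rewrite orientN; nra.
(* The midpoint is not to the left of the separating edge of [S], whereas [a] and [b] are not to its
   right. So both are its ends, and [T] lies across the diagonal. *)
have [u [v [uv Huv]]] := edge_separatedP _ _ (Dsep S T SD TD ST).
have q0 : o u v q <= 0.
  rewrite -oppr_ge0 -orientN; apply: (hull_orient_ge0 Tq) => i iT.
  by rewrite orientN oppr_ge0 orient_le0 Huv.
have /dedgeP[_ _ _ HSuv] := uv.
have ua : (a == u) || (a == v).
  apply: contraT; rewrite negb_or => /andP[au av]; have := ccw_orient (HSuv a aS au av).
  have := dedge_orient uv bS; move: q0; rewrite oq; lra.
have ub : (b == u) || (b == v).
  apply: contraT; rewrite negb_or => /andP[bu bv]; have := ccw_orient (HSuv b bS bu bv).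
  have := dedge_orient uv aS; move: q0; rewrite oq; lra.
have [Eu Ev] : u = a /\ v = b.
  case/orP: ua => /eqP Ea; case/orP: ub => /eqP Eb; subst => //.
  - by rewrite eqxx in ab.
  - by rewrite (negbTE (dedge_asym (D2 _ SD) Sab)) in uv.
  - by rewrite eqxx in ab.
subst; exists T => //; apply: (midpoint_mem N0 ba _ Tq).
  by rewrite /q /segment; congr pair; lra.
move=> d dT db da; rewrite ccw_rot; apply: ccw_or; rewrite 1?eq_sym //.
exact: Huv.
Qed.

(** Covering is proved by descent: a piece missing [q] has an edge with [q] strictly on its right,
    and one of least [gap] is chosen. *)
Lemma tiling_dissection k D : (2 < k)%N -> tiling k D -> is_dissection p k #|D| D.
Proof.
move=> k2 tD; have D2 S := @tiling_card_gt2 _ _ _ k2 tD S.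
split => //; first exact: tiling_card tD.
  move=> S T SD TD /eqP ST; apply: separated_nonoverlapping; first exact: D2.
  exact: tiling_separated tD _ _ SD TD ST.
apply/seteqP; split => [q [S SD]|q qP]; first exact/hullS/finset.subsetT.
apply: contrapT => nq.
have H S : S \in D -> exists a b, dedge S a b /\ o a b q < 0.
  move=> SD; apply: contrapT => nab; apply: nq; exists S => //.
  apply: hull_halfplanes; first exact: D2.
  by move=> a b ab; rewrite leNgt; apply/negP => h; apply: nab; exists a, b.
have [S0 S0D _] := tiling_boundary tD ord0.
have [a0 [b0 [ab0 q0]]] := H S0 S0D.
pose P (i : {set 'I_N.+2} * 'I_N.+2 * 'I_N.+2) :=
  [&& i.1.1 \in D, dedge i.1.1 i.1.2 i.2 & o i.1.2 i.2 q < 0].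
(* Crossing the edge of a piece that separates it from [q] leads to a piece
   with such an edge closer to [q]. *)
have P0 : P (S0, a0, b0) by rewrite /P /= S0D ab0.
case: (arg_minnP (fun i => gap i.1.2 i.2) P0) => -[[S a] b] /and3P[/= SD ab qab] Hmin.
(* The whole polygon, and so [q], is on the left of every boundary edge. *)
have nb : b != (a + 1)%R.
  apply: contraTneq qab => ->; rewrite -leNgt; apply: (hull_orient_ge0 qP) => c _.
  rewrite leNgt -oppr_gt0 -orientN orient_gt0 /ccw ordDE /= modn_small //.
  have := ltn_ord a; have := ltn_ord c; case: ifP; clear; lia.
have [T TD Tba] := tiling_inner tD SD ab nb.
have [a' [b' [ab' q']]] := H T TD.
have := Hmin (T, a', b'); rewrite /P /= TD ab' q' => /(_ isT).
apply/negP; rewrite -ltnNge; apply: (dedge_gap (D2 _ TD) Tba ab').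
by apply: contraTneq q' => -[-> ->]; rewrite orientN -leNgt oppr_ge0 ltW.
Qed.

End ConvexPolygon.

(** * Counting *)

Lemma eq_set2 (T : finType) (a b c d : T) : a != b -> [set a; b]%SET = [set c; d]%SET ->
  (a = c /\ b = d) \/ (a = d /\ b = c).
Proof.
move=> ab /finset.setP E; have := E a; have := E b; rewrite !inE !eqxx orbT /=.
move=> /esym/orP[]/eqP bE /esym/orP[]/eqP aE; subst; rewrite ?eqxx in ab *;
  by [|left|right].
Qed.

Lemma ord_max_succ N : ord_max + 1 = ord0 :> 'I_N.+2.
Proof. by apply: val_inj; rewrite /= [(1 %% _)%N]modn_small // addn1 modnn. Qed.

(** * The checkerboard colouring and its behaviour under rotation *)

Section Checkerboard.
Context {R : realType} {N : nat} (p : 'I_N.+2 -> R * R) (hp : strictly_convex p).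
Variables (k : nat) (k2 : (2 < k)%N).
Implicit Types (a b : 'I_N.+2) (S T s : {set 'I_N.+2}) (D B : {set {set 'I_N.+2}}).

Lemma mem_edges S s : s \in edges p S <-> exists a b, dedge S a b /\ s = [set a; b]%SET.
Proof.
split=> [/imset2P[a b aS + ->]|[a [b [ab ->]]]].
  rewrite inE => /andP[bS /andP[ab /forall_inP H]]; exists a, b; split => //.
  rewrite /dedge aS bS ab; apply/forall_inP => c cS; rewrite -(orient_gt0 hp); exact: H.
have /and4P[aS bS nab /forall_inP H] := ab.
apply/imset2P; exists a b => //; rewrite inE bS nab.
by apply/forall_inP => c cS; rewrite orient_gt0 // H.
Qed.

Lemma marked_edge_dedge S : (2 < #|S|)%N ->
  marked_edge N \in edges p S <-> dedge S ord_max ord0.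
Proof.
move=> S2; split => [/mem_edges[a [b [ab E]]]|h]; last first.
  by apply/mem_edges; exists ord_max, ord0.
have /dedgeP[aS bS nab H] := ab.
case: (eq_set2 nab (esym E)) => -[? ?]; subst => //.
have [c cS /andP[co cm]] := dedge_other ord0 ord_max S2.
by have := H c cS co cm; rewrite ccw_ltE //= ltnNge -ltnS ltn_ord.
Qed.

(** Distinct pieces that share an edge traverse it in opposite directions, by [tiling_dedge_inj]. *)
Lemma checkerboardP D B : tiling k D ->
  reflect (coloring D B /\ forall S, S \in D -> dedge S ord_max ord0 -> S \in B)
    (checkerboard p D B).
Proof.
move=> tD; have D2 S := @tiling_card_gt2 _ _ _ k2 tD S.
apply: (iffP and3P) => [[BD /forall_inP Hr /forall_inP Ha]|[[BD Ha] Hr]]; split.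
- split=> // S T a b SD TD Sab Tba.
  have /forall_inP := Ha S SD => /(_ T TD)/implyP; apply.
  apply/andP; split.
    by apply: contraTneq Tba => <-; rewrite dedge_asym // D2.
  apply/set0Pn; exists [set a; b]%SET; rewrite inE; apply/andP; split; apply/mem_edges.
    by exists a, b.
  by exists b, a; split => //; rewrite finset.setUC.
- by move=> S SD S0; apply: (implyP (Hr S SD)); apply/marked_edge_dedge; rewrite ?D2.
- exact: BD.
- apply/forall_inP => S SD; apply/implyP => /marked_edge_dedge-/(_ (D2 _ SD)).
  exact: Hr.
- apply/forall_inP => S SD; apply/forall_inP => T TD.
  apply/implyP => /andP[ST /set0Pn[s]].
  rewrite inE => /andP[/mem_edges[a [b [Sab ->]]] /mem_edges[a' [b' [Tab E]]]].
  have /dedgeP[_ _ nab _] := Sab.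
  case: (eq_set2 nab E) => -[? ?]; subst; last exact: Ha Sab Tab.
  by rewrite (tiling_dedge_inj k2 tD SD TD Sab Tab) eqxx in ST.
Qed.

Lemma marked_exists D : tiling k D -> exists2 S, S \in D & dedge S ord_max ord0.
Proof.
move=> tD; have [S SD] := tiling_boundary tD ord_max.
by rewrite ord_max_succ => S0; exists S.
Qed.

(** The set picked by [black] is determined, by [coloring_uniq]. *)
Lemma black_eq D B : tiling k D -> checkerboard p D B -> black p D = B.
Proof.
move=> tD HB; rewrite /black; case: pickP => [B' HB'|/(_ B)]; last by rewrite HB.
have [S SD S0] := marked_exists tD.
move: HB HB' => /(checkerboardP _ tD)[cB rB] /(checkerboardP _ tD)[cB' rB'] /=.
by apply: (coloring_uniq k2 tD cB' cB SD S0); rewrite rB ?rB'.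
Qed.

Lemma black_checkerboard D : tiling k D -> checkerboard p D (black p D).
Proof.
move=> tD; suff h : checkerboard p D (canonical_black D) by rewrite (black_eq tD h).
apply/checkerboardP => //; split; first exact: canonical_coloring k2 tD.
by move=> S; apply: canonical_root k2 tD _.
Qed.

Definition imbalance D : int := (n_b p D)%:Z - (n_w p D)%:Z.

Lemma imbalanceE D : tiling k D -> imbalance D = \sum_(S in D) sgc (black p D) S.
Proof. by move=> /black_checkerboard/and3P[BD _ _]; rewrite sum_sgc. Qed.

Lemma sum_boundary_sign_black D : tiling k D ->
  k%:Z * imbalance D = \sum_a boundary_sign D (black p D) a.
Proof.
move=> tD; rewrite imbalanceE // (sum_boundary_sign k2 tD) //.
by have /(checkerboardP _ tD)[] := black_checkerboard tD.
Qed.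

(* Moving the marked edge to [a, a + 1] swaps the colours iff the piece at
   this edge is white. *)
Lemma imbalance_translate D a : tiling k D ->
  imbalance (translates (ord_max - a) D) = boundary_sign D (black p D) a * imbalance D.
Proof.
move=> tD; have [S SD Sa] := tiling_boundary tD a; set i := ord_max - a.
have /(checkerboardP _ tD)[cB _] := black_checkerboard tD; set B := black p D in cB *.
(* Of [B] and its complement, the one containing [S], the piece at the new marked edge. *)
pose C := if S \in B then B else D :\: B.
have cC : coloring D C by rewrite /C; case: ifP => // _; apply: coloringC.
have tD' := tiling_translate i tD.
have CD : checkerboard p (translates i D) (translates i C).
  apply/checkerboardP => //; split; first exact: coloring_translate.
  move=> S' S'D S'0; suff -> : S' = translate i S.
    by rewrite mem_translates /C; case: ifPn => // SB; rewrite inE SB.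
  apply: (tiling_dedge_inj k2 tD' S'D _ S'0); first by rewrite mem_translates.
  have <- : a + i = ord_max by rewrite addrC subrK.
  have <- : a + 1 + i = ord0 by rewrite addrAC [a + i]addrC subrK ord_max_succ.
  by rewrite dedge_translate.
rewrite !imbalanceE // (black_eq tD' CD) (boundary_signE k2 tD _ SD Sa) -/B mulr_sumr.
rewrite big_imset /=; last by move=> x y _ _; apply: translate_inj.
apply: eq_bigr => T TD; rewrite /sgc mem_translates /C.
case: (S \in B); rewrite ?mul1r // inE TD andbT; by case: (T \in B).
Qed.

(** Each [a] gives imbalance [e a * X] with [e a] equal to 1 or -1, and the sum of [e] is [k * X].
    The factor 2 avoids halving [1 + e a] and [1 - e a]. *)
Lemma sum_translates_imbalance D j : tiling k D ->
  2 * \sum_a (imbalance (translates (ord_max - a) D) == j)%:R =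
  (N.+2%:Z + k%:Z * j) * ((imbalance D == j)%:R + (imbalance D == - j)%:R) :> int.
Proof.
move=> tD; under eq_bigr do rewrite imbalance_translate //.
have := sum_boundary_sign_black tD; set X := imbalance D; set e := boundary_sign D _ => E.
have e1 a : e a = 1 \/ e a = -1.
  have [S SD Sa] := tiling_boundary tD a; rewrite /e (boundary_signE k2 tD _ SD Sa) /sgc.
  by case: ifP; [left|right].
have E2 a : 2 * (e a * X == j)%:R
    = (1 + e a) * (X == j)%:R + (1 - e a) * (X == - j)%:R :> int.
  case: (e1 a) => ->; first by rewrite mul1r; ring.
  by rewrite mulN1r eqr_oppLR; ring.
rewrite mulr_sumr; under eq_bigr do rewrite E2.
(* The coefficients are now [N.+2 + k * X] for [X = j] and [N.+2 - k * X] for [X = - j]; both equal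
   [N.+2 + k * j]. *)
rewrite big_split /= -!mulr_suml big_split /= sumrB -E sumr_const card_ord.
rewrite (natz N.+2); case: (eqVneq X j) => [h1|_]; case: (eqVneq X (- j)) => [h2|_].
- have j0 : j = 0 by lra.
  by rewrite h1 j0 mulr0; ring.
- by rewrite h1 mulr1n mulr0n; ring.
- by rewrite h2 mulr1n mulr0n; ring.
- by rewrite mulr0n; ring.
Qed.

End Checkerboard.

(** * Coefficients and the final double count *)

Lemma lcoef_sum (I : finType) (P : pred I) (F : I -> laurent) j :
  lcoef (\sum_(i | P i) F i) j = \sum_(i | P i) lcoef (F i) j.
Proof.
have D (f g : laurent) : lcoef (f + g) j = lcoef f j + lcoef g j by exact: monalg.mcoeffD.
have Z : lcoef 0 j = 0 by exact: monalg.mcoeff0.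
exact: (big_morph (fun f => lcoef f j) D Z).
Qed.

Lemma lcoef_tpow i j : lcoef (tpow i) j = (i == j)%:R.
Proof. exact: monalg.mcoeffU. Qed.

Theorem theorem3p3 (R : realType) (d : nat) (hd : (2 <= d)%N) (n : nat)
    (p : 'I_((d - 1) * n).+2 -> R * R) (hp : strictly_convex p) (j : int) :
  (((d - 1) * n + 2)%N%:Z + (d + 1)%N%:Z * j) * lcoef (w d n p) (- j) =
  (((d - 1) * n + 2)%N%:Z - (d + 1)%N%:Z * j) * lcoef (w d n p) j.
Proof.
case: n p hp => [|n] p hp.
  (* Here [w] is [tpow 0] by convention: the sides coincide for [j = 0], and both coefficients
     vanish otherwise. *)
  rewrite /w !lcoef_tpow; case: (eqVneq j 0) => [->|j0].
    by rewrite !(oppr0, mulr0, addr0).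
  by rewrite !(eq_sym 0) oppr_eq0 (negbTE j0) !mulr0.
rewrite /w; set N := ((d - 1) * n.+1)%N in p hp *.
have N0 : (0 < N)%N by rewrite muln_gt0 subn_gt0 hd.
have k2 : (2 < d.+1)%N by [].
pose dis D := `[< is_dissection p d.+1 n.+1 D >].
have tiles D : dis D -> tiling d.+1 D by move=> /asboolP; apply: dissection_tiling.
(* The polygon [p] stays fixed while the labels rotate, so invariance is obtained through
   [tiling]. *)
have dis_translates i D : dis D -> dis (translates i D).
  move=> disD; apply/asboolP; have /asboolP[<- _ _ _] := disD.
  rewrite -(card_imset _ (@translate_inj _ i)).
  exact/(tiling_dissection hp k2)/tiling_translate/tiles.
rewrite !lcoef_sum; pose c i : int := \sum_(D | dis D) (imbalance p D == i)%:R.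
have cE i : \sum_(D | dis D) lcoef (tpow ((n_b p D)%:Z - (n_w p D)%:Z)) i = c i.
  by apply: eq_bigr => D _; rewrite lcoef_tpow.
rewrite !cE.
have key : 2 * (N.+2%:Z * c j) = (N.+2%:Z + d.+1%:Z * j) * (c j + c (- j)).
  have -> : N.+2%:Z * c j
      = \sum_(D | dis D) \sum_a (imbalance p (translates (ord_max - a) D) == j)%:R.
    rewrite exchange_big /= (eq_bigr (fun=> c j)) => [|a _].
      by rewrite sumr_const card_ord -mulr_natl natz.
    (* Rotation permutes the dissections, so every choice of [a] yields the same count [c j]. *)
    rewrite /c [RHS](reindex_inj (@translates_inj _ (ord_max - a))) /=.
    apply: eq_bigl => D; apply/idP/idP; first exact: dis_translates.
    by move/(dis_translates (- (ord_max - a))); rewrite translatesK.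
  rewrite mulr_sumr -big_split mulr_sumr; apply: eq_bigr => D /tiles tD.
  exact: (sum_translates_imbalance hp k2).
have -> : (N + 2)%N = N.+2 by rewrite addn2.
have -> : (d + 1)%N = d.+1 by rewrite addn1.
(* Moving the [c j] term of [key] to the left leaves [N.+2 - d.+1 * j] as its coefficient. *)
lra.
Qed.
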